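(* Let $n\geq 1$ and let $\sigma,\sigma'$ be two permutations of $\{1,\dots,n\}$, considered as spindle-permutations. Then $\sigma$ and $\sigma'$ define the same switching class (that is, their linking matrices $X(\sigma)$ and $X(\sigma')$ are switching-equivalent) if and only if $\sigma$ and $\sigma'$ are spindle-equivalent.
   Context: A spindle-permutation is a permutation $\sigma$ of $\{1,\dots,n\}$. (It encodes a spindle, i.e. a configuration of $n$ pairwise skew lines in $\mathbb{R}^3$ all intersecting an auxiliary oriented line, its axis.) Its linking matrix is the symmetric $n\times n$ matrix $X(\sigma)$ with coefficients $$x_{i,j}=\mathrm{sign}\big((i-j)(\sigma(i)-\sigma(j))\big),$$ where $\mathrm{sign}(0)=0$ and $\mathrm{sign}(x)=x/|x|$ for $x\neq 0$. Two symmetric $n\times n$ matrices $X,Y$ with zero diagonal and off-diagonal coefficients in $\{\pm1\}$ are switching-equivalent if $Y=D\,P^t\,X\,P\,D$ for some permutation matrix $P$ and some diagonal matrix $D$ with diagonal entries in $\{\pm 1\}$. A switching class is an equivalence class for this relation. The switching class defined by $\sigma$ is the class of $X(\sigma)$. Spindle-equivalence is the equivalence relation on permutations of $\{1,\dots,n\}$ generated by the following three moves, where $[1,k]=\{1,\dots,k\}$: (1) (Circular move) $\sigma\sim\mu$ if there are integers $0\leq s,t<n$ such that $\mu(i)=\big(s+\sigma((i+t)\bmod n)\big)\bmod n$ for all $i$, where all integers are taken modulo $n$ with representatives in $\{1,\dots,n\}$. (2) (Vertical reflection of a block) $\sigma\sim\mu$ if there is an integer $1\leq k\leq n$ with $\sigma([1,k])=[1,k]$,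 $\mu(i)=k+1-\sigma(k+1-i)$ for $i\leq k$, and $\mu(i)=\sigma(i)$ for $i>k$. (3) (Horizontal reflection of a block) $\sigma\sim\mu$ if there is an integer $1<k\leq n$ with $\sigma([1,k])=[1,k]$, $\mu(i)=\sigma^{-1}(i)$ for $i\leq k$, and $\mu(i)=\sigma(i)$ for $i>k$. *)

(* Defs.v *)
From Stdlib Require Import Relation_Operators.
From mathcomp Require Import all_boot all_order all_algebra all_fingroup.

Set Implicit Arguments.
Unset Strict Implicit.
Unset Printing Implicit Defensive.

Import Order.TTheory GRing.Theory Num.Theory.
Local Open Scope ring_scope.

(* The set {1, ..., n} is represented by 'I_n = {0, ..., n-1}: the ordinal i
   stands for the label i + 1.  All formulas below are shifted accordingly. *)

Definition linking_mx (n : nat) (sigma : 'S_n) : 'M[int]_n :=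
  \matrix_(i, j)
    Num.sg (((i : nat)%:Z - (j : nat)%:Z)
            * ((sigma i : nat)%:Z - (sigma j : nat)%:Z)).

Definition switching_matrix (n : nat) (X : 'M[int]_n) : Prop :=
  [/\ X^T = X,
      forall i, X i i = 0
    & forall i j, i != j -> X i j = 1 \/ X i j = -1].

Definition sign_diag_mx (n : nat) (D : 'M[int]_n) : Prop :=
  is_diag_mx D /\ forall i, D i i = 1 \/ D i i = -1.

(* Meant for X and Y satisfying switching_matrix; linking matrices do, see
   linking_mx_switching. *)
Definition switching_equiv (n : nat) (X Y : 'M[int]_n) : Prop :=
  exists P D : 'M[int]_n,
    [/\ is_perm_mx P, sign_diag_mx D & Y = D *m P^T *m X *m P *m D].

(* Shifting labels by one, "mod n with representatives in {1, ..., n}" becomes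
   the usual remainder in {0, ..., n-1}. Here j is the argument of sigma,
   determined by i. *)
Definition circular_move (n : nat) (sigma mu : 'S_n) : Prop :=
  exists s t : nat,
    [/\ (s < n)%N, (t < n)%N &
      forall i j : 'I_n, j = ((i + t) %% n)%N :> nat ->
        mu i = ((s + sigma j) %% n)%N :> nat].

(* The ordinals with labels in [1, k]. *)
Definition initial_block (n k : nat) : {set 'I_n} :=
  [set i : 'I_n | (i < k)%N].

(* k - 1 - i is the ordinal of label k + 1 - (i + 1).  Both subtractions are
   exact, because i < k and sigma preserves the block. *)
Definition vertical_reflection (n : nat) (sigma mu : 'S_n) : Prop :=
  exists k : nat,
    [/\ (1 <= k <= n)%N,
        sigma @: initial_block n k = initial_block n k,
        forall i j : 'I_n, (i < k)%N -> j = (k - 1 - i)%N :> nat ->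
          mu i = (k - 1 - sigma j)%N :> nat
      & forall i : 'I_n, (k <= i)%N -> mu i = sigma i].

Definition horizontal_reflection (n : nat) (sigma mu : 'S_n) : Prop :=
  exists k : nat,
    [/\ (1 < k <= n)%N,
        sigma @: initial_block n k = initial_block n k,
        forall i : 'I_n, (i < k)%N -> mu i = (sigma^-1)%g i
      & forall i : 'I_n, (k <= i)%N -> mu i = sigma i].

Definition spindle_move (n : nat) (sigma mu : 'S_n) : Prop :=
  [\/ circular_move sigma mu,
      vertical_reflection sigma mu
    | horizontal_reflection sigma mu].

Definition spindle_equiv (n : nat) : 'S_n -> 'S_n -> Prop :=
  clos_refl_sym_trans 'S_n (@spindle_move n).

Lemma linking_mx_switching (n : nat) (sigma : 'S_n) :
  switching_matrix (linking_mx sigma).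
Proof.
split=> [|i|i j neq_ij].
- by apply/matrixP=> i j; rewrite !mxE -mulrNN !opprB.
- by rewrite mxE subrr mul0r sgr0.
rewrite mxE; set z := _ * _.
have z_neq0 : z != 0.
  rewrite mulf_neq0 // subr_eq0 eqz_nat //.
  by rewrite (inj_eq val_inj) (inj_eq perm_inj).
by case: sgrP z_neq0 => //; [left | right].
Qed.

(* Main.v *)
(* If sigma and sigma' are switching-equivalent, circular moves bring a pair of
   corresponding lines to the first place for both orders, after which the
   linking matrices are equal up to a relabelling: the two permutations have
   isomorphic inversion graphs, i.e. they come from pairs of linear orders
   (a, b) and (a', b') on the same set of lines, with a and b agreeing on the
   same pairs as a' and b'. Colour a pair of lines 0 if a and b disagree on it,
   otherwise 1 or 2 according to whether a and a' agree on it or not. No triangle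
   has three colours, so by Gallai's theorem some colour is disconnected on any
   set of lines. Moreover every colour component is an interval for both a and b,
   that is a block of the permutation, and blocks may be inverted and reversed by
   spindle moves (conjugated by circular moves). Flipping a suitable block and
   flipping back the colour components in it turns around pairs of colour 2 and
   none of colour 1, so that a and a' disagree on fewer pairs. Pairs on which a
   and b disagree are treated in the same way after reversing b and b'. *)
Require Import Defs.
From Stdlib Require Import Relation_Operators.
From mathcomp Require Import all_boot all_order all_algebra all_fingroup.
From mathcomp Require Import zify ring.

Set Implicit Arguments.
Unset Strict Implicit.
Unset Printing Implicit Defensive.

Import GRing.Theory Num.Theory.

(** * Colourings without rainbow triangles *)

Section Gallai.
Context (V : finType) (col : V -> V -> nat).

Definition color_edge (W : {set V}) (c : nat) : rel V :=
  fun x y => [&& x \in W, y \in W, x != y & col x y == c].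

Context (colC : forall x y, x != y -> col x y = col y x).
Context (no_rainbow : forall x y z, x != y -> y != z -> x != z ->
  [|| col x y == col y z, col y z == col x z | col x y == col x z]).

Lemma color_edge_sym W c : symmetric (color_edge W c).
Proof.
move=> x y; rewrite /color_edge eq_sym; case: eqVneq => [|nyx]; first by rewrite !andbF.
by rewrite (colC nyx) andbCA.
Qed.

Lemma color_connect_sym W c : connect_sym (color_edge W c).
Proof. exact/sym_connect_sym/color_edge_sym. Qed.

Lemma color_connect_in (W : {set V}) c x y :
  connect (color_edge W c) x y -> x \in W -> y \in W.
Proof.
case/connectP=> p + ->; elim: p x => //= z p IHp x /andP[/and4P[_ zW _ _] zp] _.
exact: IHp.
Qed.

(** For an edge uv of the path, the triangle u, v, z has colour [c] on uv only. As it is not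
    rainbow, uz and vz have the same colour. *)
Lemma col_component (W : {set V}) c x y z : x \in W -> z \in W ->
  connect (color_edge W c) x y -> ~~ connect (color_edge W c) x z ->
  (col x z == col y z) && (col y z != c).
Proof.
move=> + zW /connectP[p + ->].
have key u v : color_edge W c u v -> ~~ connect (color_edge W c) u z ->
  [/\ u != z, v != z, col u z != c, col v z != c & col u z = col v z].
  move=> uv uz; have /and4P[uW vW nuv /eqP cuv] := uv.
  have vz : ~~ connect (color_edge W c) v z.
    by apply: contraNN uz; apply: connect_trans (connect1 uv).
  have nuz : u != z by apply: contraNneq uz => ->; apply: connect0.
  have nvz : v != z by apply: contraNneq vz => ->; apply: connect0.
  have cuz : col u z != c.
    by apply: contraNN uz => /eqP ?; apply/connect1/and4P; split=> //; apply/eqP.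
  have cvz : col v z != c.
    by apply: contraNN vz => /eqP ?; apply/connect1/and4P; split=> //; apply/eqP.
  split=> //; have := no_rainbow nuv nvz nuz; rewrite cuv.
  by rewrite ![c == _]eq_sym (negPf cuz) (negPf cvz) orbF => /eqP.
elim: p x => [|v p IHp] x /= xW => [_|/andP[xv vp]] nxz.
  rewrite eqxx; apply: contraNN nxz => cxz; case: (eqVneq x z) => [->|nxz].
    exact: connect0.
  by apply/connect1/and4P.
have [_ _ _ _ ->] := key _ _ xv nxz; apply: IHp => //; first by case/and4P: xv.
by apply: contraNN nxz; apply: connect_trans (connect1 xv).
Qed.

Lemma color_connect_nbr W c v x :
  connect (color_edge W c) v x -> v != x -> exists y, color_edge W c v y.
Proof.
case/connectP=> -[|y p] /= => [_ -> /eqP|/andP[vy _] _ _] //; by exists y.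
Qed.

(** The path is cut just before its first visit to [v]. *)
Lemma color_connect_last (W : {set V}) c z v : z \in W -> z != v ->
  connect (color_edge W c) z v ->
  exists2 u, connect (color_edge (W :\ v) c) z u & color_edge W c u v.
Proof.
move=> zW nzv /connectP[p zp ev]; elim: p z zW nzv zp ev => [|u p IHp] z zW nzv /=.
  by move=> _ ev; rewrite ev eqxx in nzv.
move=> /andP[zu up] ev; have /and4P[_ uW nzu czu] := zu.
have [<-|nuv] := eqVneq u v; first by exists z; rewrite ?connect0.
have [w uw wv] := IHp u uW nuv up ev; exists w => //.
apply: connect_trans uw; apply: connect1.
by rewrite /color_edge !inE nzv nuv zW uW nzu.
Qed.

(* Gallai. Remove a vertex v; by induction some colour c is disconnected on the
   rest. If all colours were connected, an edge from v to x of another colour d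
   would force colour d on all edges leaving the c-component of x, and applying
   this to both other colours gives a contradiction. *)
Lemma disconnected_color (W : {set V}) : 1 < #|W| ->
  exists2 c, c < 3 & exists x y, [/\ x \in W, y \in W & ~~ connect (color_edge W c) x y].
Proof.
have [m] := ubnP #|W|; elim: m W => // m IHm W leWm gtW1.
suff: ~~ [forall c : 'I_3, [forall x in W, forall y in W, connect (color_edge W c) x y]].
  case/forallPn=> c /forall_inPn[x xW /forall_inPn[y yW nxy]].
  by exists c => //; exists x, y.
apply/negP => /forallP conW.
have {}conW c x y : c < 3 -> x \in W -> y \in W -> connect (color_edge W c) x y.
  by move=> lt_c xW yW; have /forall_inP/(_ x xW)/forall_inP := conW (Ordinal lt_c); apply.
have /card_gt0P[v vW] : 0 < #|W| by lia.
have cW' : #|W| = #|W :\ v|.+1 by rewrite (cardsD1 v W) vW.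
have nbr c : c < 3 -> exists y, [/\ y \in W :\ v & col v y = c].
  move=> lt_c; have /card_gt0P[x] : 0 < #|W :\ v| by lia.
  rewrite !inE => /andP[nxv xW].
  have [|y /and4P[_ yW nvy /eqP cvy]] := color_connect_nbr (conW c v x lt_c vW xW).
    by rewrite eq_sym.
  by exists y; rewrite !inE eq_sym nvy.
have [cW'1 | gtW'1] := leqP #|W :\ v| 1.
  have [x [xW' cx]] := nbr 0 isT; have [y [yW' cy]] := nbr 1 isT.
  by move/card_le1_eqP/(_ _ _ xW' yW'): cW'1 => exy; move: cx; rewrite -exy cy.
have [|c lt_c3 [x0 [y0 [x0W y0W nxy0]]]] := IHm (W :\ v) _ gtW'1; first by lia.
set e := color_edge (W :\ v) c in nxy0.
have far x : exists2 z, z \in W :\ v & ~~ connect e x z.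
  have [xx0|] := boolP (connect e x x0); last by exists x0.
  exists y0 => //; apply: contraNN nxy0; apply: connect_trans.
  by rewrite color_connect_sym.
have key d x z : d != c -> x \in W :\ v -> col v x = d -> z \in W :\ v ->
    ~~ connect e x z -> col x z = d.
  move=> ndc xW' cvx zW' nxz; have /setD1P[nzv zW] := zW'; have /setD1P[nxv xW] := xW'.
  (* [u] is in the component of [z], so ux has the colour of zx, which is not [c]. Since uv has
     colour [c] and vx colour [d], the triangle u, v, x gives ux the colour [d]. *)
  have [u zu /and4P[uW _ nuv /eqP cuv]] :=
    color_connect_last zW nzv (conW c z v lt_c3 zW vW).
  have nzx : ~~ connect e z x by rewrite color_connect_sym.
  have /andP[/eqP czx cux] := col_component zW' xW' zu nzx.
  have nxu : x != u by apply: contraNneq nzx => ->.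
  have nxz' : x != z by apply: contraNneq nzx => ->; apply: connect0.
  rewrite (colC nxz') czx.
have := no_rainbow nuv (_ : v != x) (_ : u != x).
rewrite cuv cvx ![c == _]eq_sym (negPf ndc) (negPf cux) orbF [v == x]eq_sym nxv.
by rewrite [u == x]eq_sym nxu => /(_ isT isT) /eqP.
have [d1 [d2 [lt1 lt2 n1 n2 n12]]] :
    exists d1 d2, [/\ d1 < 3, d2 < 3, d1 != c, d2 != c & d1 != d2].
  by case: c lt_c3 {far key e nxy0} => [|[|[|]]] // _;
    [exists 1, 2 | exists 0, 2 | exists 0, 1].
have [x [xW' cx]] := nbr d1 lt1; have [y [yW' cy]] := nbr d2 lt2.
(* If [x] and [y] share a component, a vertex [z] outside sees both in the same colour, which would
   be [d1] and [d2]. Otherwise the edge xy itself has both colours. *)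
have [exy|nxy] := boolP (connect e x y).
  have [z zW' nxz] := far x.
  have /andP[/eqP cxyz _] := col_component xW' zW' exy nxz.
  have nyz : ~~ connect e y z by apply: contraNN nxz; apply: connect_trans.
  by move: n12; rewrite -(key d1 x z) // -(key d2 y z) // cxyz eqxx.
have nxy' : x != y by apply: contraNneq nxy => ->; apply: connect0.
have nyx : ~~ connect e y x by rewrite color_connect_sym.
by move: n12; rewrite -(key d1 x y) // -(key d2 y x) // colC ?eqxx.
Qed.

End Gallai.

(** * Flipping a block by spindle moves *)

Lemma perm_of_nat_inj n (f : 'I_n -> nat) :
  (forall x, f x < n) -> injective f -> exists p : 'S_n, forall x, p x = f x :> nat.
Proof.
move=> ltf injf; pose g x := Ordinal (ltf x).
have injg : injective g by move=> x y [/injf].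
by exists (perm injg) => x; rewrite permE.
Qed.

Lemma card_ord_lt n m : m <= n -> #|[set i : 'I_n | i < m]| = m.
Proof.
by move=> le_mn; rewrite -sum1dep_card (big_ord_narrow le_mn) sum1_card card_ord.
Qed.

(** A value is recovered from the order as the number of smaller values. *)
Lemma perm_eq_ltn n (p q : 'S_n) :
  (forall x y, (p x < p y) = (q x < q y)) -> p = q.
Proof.
have card_lt (r : 'S_n) x : #|[set y | r y < r x]| = r x.
  have -> : [set y | r y < r x] = r @^-1: [set i : 'I_n | i < r x].
    by apply/setP=> y; rewrite !inE.
  by rewrite card_preimset ?card_ord_lt 1?ltnW //; exact: perm_inj.
move=> pq; apply/permP=> x; apply/ord_inj; rewrite -card_lt -[RHS]card_lt.
by congr #|pred_of_set _|; apply/setP=> y; rewrite !inE pq.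
Qed.

Lemma val_perm_neq n (p : 'S_n) x y : x != y -> p x != p y :> nat.
Proof. by rewrite (inj_eq val_inj) (inj_eq perm_inj). Qed.

Lemma spindle_sym n (s t : 'S_n) : spindle_equiv s t -> spindle_equiv t s.
Proof. exact: rst_sym. Qed.

Lemma spindle_trans n (s t u : 'S_n) :
  spindle_equiv s t -> spindle_equiv t u -> spindle_equiv s u.
Proof. exact: rst_trans. Qed.

Lemma rot_ord_proof n (t : nat) (x : 'I_n) : (x + t) %% n < n.
Proof. by rewrite ltn_mod; case: n x => [[]|]. Qed.

Lemma rot_ord_inj n t : injective (fun x : 'I_n => Ordinal (rot_ord_proof t x)).
Proof.
move=> x y [/eqP]; rewrite eqn_modDr !modn_small // => /eqP; exact: val_inj.
Qed.

Definition rotp n t : 'S_n := perm (@rot_ord_inj n t).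

Lemma rotpE n t x : rotp n t x = (x + t) %% n :> nat.
Proof. by rewrite permE. Qed.

Lemma rotp_modn n t : rotp n (t %% n) = rotp n t.
Proof. by apply/permP=> x; apply/ord_inj; rewrite !rotpE modnDmr. Qed.

Lemma rotpK n t : t <= n -> (rotp n (n - t) * rotp n t)%g = 1%g.
Proof.
move=> le_tn; apply/permP=> x; apply/val_inj.
by rewrite /= permM perm1 !rotpE modnDml -addnA subnK // modnDr modn_small.
Qed.

Lemma rotp_sub n l (x : 'I_n) : l <= n ->
  rotp n (n - l) x = (if l <= x then x - l else x + n - l) :> nat.
Proof.
move=> le_ln; rewrite rotpE; have ltxn := ltn_ord x; case: leqP => lx.
  by rewrite addnBA // -addnBAC // modnDr modn_small // (leq_ltn_trans (leq_subr _ _)).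
by rewrite addnBA // modn_small //; lia.
Qed.

Lemma circular_equiv n (sigma : 'S_n) s t :
  spindle_equiv sigma (rotp n t * sigma * rotp n s)%g.
Proof.
have [n0|n_gt0] := posnP n.
  suff -> : (rotp n t * sigma * rotp n s)%g = sigma by apply: rst_refl.
  by apply/permP=> x; have := ltn_ord x; rewrite {2}n0.
rewrite -(rotp_modn n t) -(rotp_modn n s); apply: rst_step; constructor 1.
exists (s %% n), (t %% n); split; rewrite ?ltn_mod // => i j ej.
rewrite !permM rotpE addnC; congr ((_ + nat_of_ord (sigma _)) %% n).
by apply/ord_inj; rewrite rotpE.
Qed.

Section Configurations.
Context (n : nat).
Implicit Types (c : 'S_n * 'S_n) (S W : {set 'I_n}).

(* A pair of numberings of the lines, by their order along the axis and by
   their angular order; the lines themselves keep fixed names. *)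
Definition config_perm c : 'S_n := (c.1^-1 * c.2)%g.

Lemma config_permE c x : config_perm c (c.1 x) = c.2 x.
Proof. by rewrite permM permK. Qed.

Lemma config_permVE c x : (config_perm c)^-1%g (c.2 x) = c.1 x.
Proof. by rewrite -(config_permE c x) permK. Qed.

Lemma config_perm_block c k : (forall x, (c.1 x < k) = (c.2 x < k)) ->
  config_perm c @: initial_block n k = initial_block n k.
Proof.
move=> ck; apply/setP=> i; rewrite -[i](permKV c.2) -config_permE.
rewrite mem_imset ?inE; last exact: perm_inj.
by rewrite ck config_permE.
Qed.

Lemma initial_horizontal c c1 k : k <= n ->
  (forall x, (c.1 x < k) = (c.2 x < k)) ->
  (forall x, c.1 x < k -> c1.1 x = c.2 x /\ c1.2 x = c.1 x) ->
  (forall x, k <= c.1 x -> c1.1 x = c.1 x /\ c1.2 x = c.2 x) ->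
  spindle_equiv (config_perm c) (config_perm c1).
Proof.
move=> le_kn ck cin cout; have [gt_k1|le_k1] := ltnP 1 k.
  apply: rst_step; constructor 3; exists k; split; rewrite ?gt_k1 //.
  - exact: config_perm_block.
  - move=> i; rewrite -[i](permKV c1.1); set x := (c1.1)^-1%g i; rewrite config_permE.
    have [ltx|] := ltnP (c.1 x) k; first by have [-> ->] := cin x ltx; rewrite config_permVE.
    by move=> lex; have [-> _] := cout x lex; rewrite ltnNge lex.
  move=> i; rewrite -[i](permKV c1.1); set x := (c1.1)^-1%g i; rewrite config_permE.
  have [ltx|] := ltnP (c.1 x) k; first by have [-> _] := cin x ltx; rewrite leqNgt -ck ltx.
  by move=> lex _; have [-> ->] := cout x lex; rewrite config_permE.
(* The move requires [1 < k]. For smaller [k] the block has at most one line, numbered 0 in both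
   orders, and the exchange changes nothing. *)
suff [e1 e2] : c1.1 = c.1 /\ c1.2 = c.2 by rewrite /config_perm e1 e2; apply: rst_refl.
have key x : c1.1 x = c.1 x /\ c1.2 x = c.2 x.
  have [ltx|] := ltnP (c.1 x) k; last exact: cout.
  have [-> ->] := cin x ltx; move: (ck x); rewrite ltx => /esym ltx2.
  suff -> : c.1 x = c.2 x by [].
  apply/ord_inj; lia.
by split; apply/permP=> x; case: (key x).
Qed.

Lemma initial_vertical c c1 k : 0 < k <= n ->
  (forall x, (c.1 x < k) = (c.2 x < k)) ->
  (forall x, c.1 x < k -> c1.1 x = k - 1 - c.1 x :> nat /\ c1.2 x = k - 1 - c.2 x :> nat) ->
  (forall x, k <= c.1 x -> c1.1 x = c.1 x /\ c1.2 x = c.2 x) ->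
  spindle_equiv (config_perm c) (config_perm c1).
Proof.
move=> le_kn ck cin cout; apply: rst_step; constructor 2; exists k; split=> //.
- exact: config_perm_block.
- move=> i j; rewrite -[i](permKV c1.1); set x := (c1.1)^-1%g i; rewrite config_permE.
  have [ltx|] := ltnP (c.1 x) k; last first.
    by move=> lex; have [-> _] := cout x lex; rewrite ltnNge lex.
  have [-> ->] := cin x ltx => _ ej; suff -> : j = c.1 x by rewrite config_permE.
  by apply/ord_inj; rewrite ej; lia.
move=> i; rewrite -[i](permKV c1.1); set x := (c1.1)^-1%g i; rewrite config_permE.
have [ltx|] := ltnP (c.1 x) k; first by have [-> _] := cin x ltx; lia.
by move=> lex _; have [-> ->] := cout x lex; rewrite config_permE.
Qed.

(** [rotp n (n - l)] subtracts [l] modulo [n], so intervals starting at [l1] and [l2] become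
    initial. *)
Definition shift c l1 l2 : 'S_n * 'S_n :=
  (c.1 * rotp n (n - l1), c.2 * rotp n (n - l2))%g.

Lemma shift_equiv c l1 l2 : l1 <= n ->
  spindle_equiv (config_perm c) (config_perm (shift c l1 l2)).
Proof.
move=> le1; suff -> :
    config_perm (shift c l1 l2) = (rotp n l1 * config_perm c * rotp n (n - l2))%g.
  exact: circular_equiv.
have e : (rotp n (n - l1))^-1%g = rotp n l1.
  by apply/eqP; rewrite eq_invg_mul rotpK.
by rewrite /config_perm /= invMg e !mulgA.
Qed.

Definition interval_block c W l1 l2 k : Prop :=
  [/\ l1 + k <= n, l2 + k <= n, forall x, (x \in W) = (l1 <= c.1 x < l1 + k)
    & forall x, (x \in W) = (l2 <= c.2 x < l2 + k)].

(** The block is shifted to the front in both orders, reflected there and shifted back. *)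
Lemma horizontal_equiv c c1 W l1 l2 k : interval_block c W l1 l2 k ->
  (forall x, x \in W -> c1.1 x = l1 + (c.2 x - l2) :> nat /\
                        c1.2 x = l2 + (c.1 x - l1) :> nat) ->
  (forall x, x \notin W -> c1.1 x = c.1 x /\ c1.2 x = c.2 x) ->
  spindle_equiv (config_perm c) (config_perm c1).
Proof.
move=> [l1n l2n W1 W2] cin cout; have le1 : l1 <= n by lia.
have le2 : l2 <= n by lia.
apply: spindle_trans (shift_equiv c l2 le1) _.
apply: spindle_trans (spindle_sym (shift_equiv c1 l2 le1)).
have v1 d x : (shift d l1 l2).1 x = 
  (if l1 <= d.1 x then d.1 x - l1 else d.1 x + n - l1) :> nat by rewrite permM rotp_sub.
have v2 d x : (shift d l1 l2).2 x = 
  (if l2 <= d.2 x then d.2 x - l2 else d.2 x + n - l2) :> nat by rewrite permM rotp_sub.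
have sW x : ((shift c l1 l2).1 x < k) = (x \in W).
  by rewrite v1 W1; have := ltn_ord (c.1 x); case: ifP; lia.
apply: (@initial_horizontal _ _ k) => [||x|x].
- lia.
- by move=> x; rewrite sW v2 W2; have := ltn_ord (c.2 x); case: ifP; lia.
- rewrite sW => xW; have [e1 e2] := cin x xW.
  have [la1 la2] : l1 <= c.1 x /\ l2 <= c.2 x by move: (W1 x) (W2 x); rewrite xW; lia.
  by split; apply/ord_inj; rewrite v1 v2 ?e1 ?e2 leq_addr addKn ?la1 ?la2.
rewrite leqNgt sW => xW; have [e1 e2] := cout x xW.
by rewrite !permM e1 e2.
Qed.

Lemma vertical_equiv c c1 W l1 l2 k : interval_block c W l1 l2 k ->
  (forall x, x \in W -> c1.1 x = l1 + (l1 + k - 1 - c.1 x) :> nat /\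
                        c1.2 x = l2 + (l2 + k - 1 - c.2 x) :> nat) ->
  (forall x, x \notin W -> c1.1 x = c.1 x /\ c1.2 x = c.2 x) ->
  spindle_equiv (config_perm c) (config_perm c1).
Proof.
move=> [l1n l2n W1 W2] cin cout; have le1 : l1 <= n by lia.
have le2 : l2 <= n by lia.
apply: spindle_trans (shift_equiv c l2 le1) _.
apply: spindle_trans (spindle_sym (shift_equiv c1 l2 le1)).
have v1 d x : (shift d l1 l2).1 x = 
  (if l1 <= d.1 x then d.1 x - l1 else d.1 x + n - l1) :> nat by rewrite permM rotp_sub.
have v2 d x : (shift d l1 l2).2 x = 
  (if l2 <= d.2 x then d.2 x - l2 else d.2 x + n - l2) :> nat by rewrite permM rotp_sub.
have sW x : ((shift c l1 l2).1 x < k) = (x \in W).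
  by rewrite v1 W1; have := ltn_ord (c.1 x); case: ifP; lia.
have [k0|k_gt0] := posnP k.
  suff [e1 e2] : c1.1 = c.1 /\ c1.2 = c.2 by rewrite /config_perm /= e1 e2; apply: rst_refl.
  have key x : c1.1 x = c.1 x /\ c1.2 x = c.2 x by apply: cout; rewrite W1; lia.
  by split; apply/permP=> x; case: (key x).
apply: (@initial_vertical _ _ k) => [||x|x].
- lia.
- by move=> x; rewrite sW v2 W2; have := ltn_ord (c.2 x); case: ifP; lia.
- rewrite sW => xW; have [e1 e2] := cin x xW.
  have [la1 la2] : l1 <= c.1 x /\ l2 <= c.2 x by move: (W1 x) (W2 x); rewrite xW; lia.
  by rewrite !v1 !v2 e1 e2 !leq_addr !addKn la1 la2; lia.
rewrite leqNgt sW => xW; have [e1 e2] := cout x xW.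
by rewrite !permM e1 e2.
Qed.

(** The extreme values on [S] enclose only values of [S], because an outside value is on the same
    side of both. Counting gives the length. *)
Lemma convex_interval (p : 'S_n) S x0 : x0 \in S ->
  (forall x y z, x \in S -> y \in S -> z \notin S -> (p x < p z) = (p y < p z)) ->
  exists2 l, l + #|S| <= n & forall x, (x \in S) = (l <= p x < l + #|S|).
Proof.
move=> x0S conv.
have [x xS minx] := arg_minnP (fun x => nat_of_ord (p x)) x0S.
have [y yS maxy] := arg_maxnP (fun x => nat_of_ord (p x)) x0S.
have inS z : (z \in S) = (p x <= p z < (p y).+1).
  have [zS|zS] := boolP (z \in S); first by rewrite minx // ltnS; have /= -> := maxy _ zS.
  have nxz : x != z by apply: contraNneq zS => <-.
  have nyz : y != z by apply: contraNneq zS => <-.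
  by have := conv _ _ _ xS yS zS; have := val_perm_neq p nxz; have := val_perm_neq p nyz; lia.
have lexy : p x <= p y by apply: minx.
suff cS : p x + #|S| = (p y).+1 by exists (p x); rewrite cS.
have -> : S = p @^-1: ([set i : 'I_n | i < (p y).+1] :\: [set i : 'I_n | i < p x]).
  by apply/setP=> z; rewrite !inE inS -leqNgt.
rewrite card_preimset; last exact: perm_inj.
rewrite cardsDS ?card_ord_lt ?subnKC //; try lia; first by rewrite ltnW.
by apply/subsetP=> i; rewrite !inE; lia.
Qed.

(** * Reversal of the second order, blocks and flips *)

Definition mirror c : 'S_n * 'S_n := (c.1, (c.2 * perm (@rev_ord_inj n))%g).

Lemma mirrorE c x : (mirror c).2 x = n - (c.2 x).+1 :> nat.
Proof. by rewrite permM permE. Qed.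

Lemma mirror_lt c x y : ((mirror c).2 x < (mirror c).2 y) = (c.2 y < c.2 x).
Proof. by rewrite !mirrorE; have := ltn_ord (c.2 x); have := ltn_ord (c.2 y); lia. Qed.

Lemma mirrorK : involutive mirror.
Proof.
case=> a b; congr pair; apply/permP=> x; apply/ord_inj.
by rewrite !mirrorE; have := ltn_ord (b x) => /=; lia.
Qed.

(** This form mentions no positions and is easy to follow through flips; [block_interval] recovers
    the intervals. *)
Definition block c S := forall x y z, x \in S -> y \in S -> z \notin S ->
  (c.1 x < c.1 z) = (c.1 y < c.1 z) /\ (c.2 x < c.2 z) = (c.2 y < c.2 z).

(* Reverses the pairs of F on which both orders agree, and keeps all others. *)
Definition flipped (F : rel 'I_n) c c1 := forall x y,
  (c1.1 x < c1.1 y) = (if F x y then c.2 y < c.2 x else c.1 x < c.1 y) /\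
  (c1.2 x < c1.2 y) = (if F x y then c.1 y < c.1 x else c.2 x < c.2 y).

(* [mirror] exchanges agreement and disagreement; asking for both equivalences
   makes [reach] invariant under it. *)
Definition reach c c1 :=
  spindle_equiv (config_perm c) (config_perm c1) /\
  spindle_equiv (config_perm (mirror c)) (config_perm (mirror c1)).

Lemma reach_refl c : reach c c.
Proof. by split; apply: rst_refl. Qed.

Lemma reach_trans c1 c2 c3 : reach c1 c2 -> reach c2 c3 -> reach c1 c3.
Proof.
by move=> [p q] [r s]; split; [exact: spindle_trans p r | exact: spindle_trans q s].
Qed.

Lemma reach_mirror c c1 : reach (mirror c) c1 -> reach c (mirror c1).
Proof. by move=> [p q]; rewrite mirrorK in q; split; rewrite ?mirrorK. Qed.

Lemma block_interval c W x0 : x0 \in W -> block c W ->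
  exists l1 l2, interval_block c W l1 l2 #|W|.
Proof.
move=> x0W blW.
have [|l1 l1n W1] := convex_interval (p := c.1) x0W.
  by move=> x y z xW yW zW; case: (blW x y z).
have [|l2 l2n W2] := convex_interval (p := c.2) x0W.
  by move=> x y z xW yW zW; case: (blW x y z).
by exists l1, l2.
Qed.

Lemma replace_on_interval (p q : 'S_n) W l l' k :
  (forall x, (x \in W) = (l <= p x < l + k)) ->
  (forall x, (x \in W) = (l' <= q x < l' + k)) -> l + k <= n ->
  (exists r : 'S_n, forall x, r x = (if x \in W then l + (q x - l') else p x) :> nat) /\
  (exists r : 'S_n, forall x,
     r x = (if x \in W then l + (l' + k - 1 - q x) else p x) :> nat).
Proof.
move=> Wp Wq le_lkn; split; apply: perm_of_nat_inj => [x|x y] /=.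
- by have := ltn_ord (p x); have := Wq x; case: ifP => _; lia.
- apply: contra_eq => nxy; have := val_perm_neq p nxy; have := val_perm_neq q nxy.
  have := Wp x; have := Wp y; have := Wq x; have := Wq y.
  case: (x \in W); case: (y \in W); lia.
- by have := ltn_ord (p x); have := Wq x; case: ifP => _; lia.
apply: contra_eq => nxy; have := val_perm_neq p nxy; have := val_perm_neq q nxy.
have := Wp x; have := Wp y; have := Wq x; have := Wq y.
case: (x \in W); case: (y \in W); lia.
Qed.

Lemma flip_block c W : block c W ->
  exists2 c1, flipped (fun x y => (x \in W) && (y \in W)) c c1 & reach c c1.
Proof.
have [->|[x0 x0W]] := set_0Vmem W.
  by exists c; [move=> x y; rewrite !inE | apply: reach_refl].
case/(block_interval x0W) => l1 [l2]; set k := #|W| => blW; have [l1n l2n W1 W2] := blW.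
have [[am ame] [a ae]] := replace_on_interval W1 W2 l1n.
have [[bm bme] [b be]] := replace_on_interval W2 W1 l2n.
exists (a, b); rewrite /=.
  move=> x y; rewrite /= !ae !be; have := W1 x; have := W1 y; have := W2 x; have := W2 y.
  by case: (x \in W); case: (y \in W) => /=; split; lia.
split.
  (* The horizontal reflection exchanges the two orders on [W] and the vertical one reverses both.
     Together they turn around the pairs on which the orders agree and no others. *)
  apply: (@spindle_trans _ _ (config_perm (am, bm))).
    apply: (horizontal_equiv blW) => x xW; first by rewrite /= ame bme xW.
    by rewrite /=; split; apply/ord_inj; rewrite ?ame ?bme (negPf xW).
  apply: (@vertical_equiv _ _ W l1 l2 k).
    split=> // x /=; rewrite ?ame ?bme; have := W1 x; have := W2 x.
      by case: (x \in W); lia.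
    by case: (x \in W); lia.
  - move=> x xW /=; rewrite ?ae ?be ?ame ?bme xW; have := W1 x; have := W2 x.
    by rewrite xW; lia.
  by move=> x xW; split; apply/ord_inj; rewrite /= ?ae ?be ?ame ?bme (negPf xW).
(* With the second order reversed, exchanging the orders on [W] is already the flip. In the reversed
   order [W] starts at [n - l2 - k]. *)
apply: (@horizontal_equiv _ _ W l1 (n - l2 - k) k).
- split=> //; first by lia.
  by move=> x; rewrite mirrorE; have := ltn_ord (c.2 x); have := W2 x; lia.
- move=> x xW; rewrite !mirrorE /= ae be xW; have := W1 x; have := W2 x.
  by rewrite xW; lia.
move=> x xW; split; apply/ord_inj; rewrite ?mirrorE /= ?ae ?be (negPf xW) //.
Qed.

Lemma flipped_block F c c1 S : flipped F c c1 ->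
  (forall x y z, x \in S -> y \in S -> z \notin S -> F x z = F y z) ->
  block c S -> block c1 S.
Proof.
move=> fl FS blS x y z xS yS zS.
have [-> ->] := fl x z; have [-> ->] := fl y z; rewrite (FS x y z) //.
have [e1 e2] := blS x y z xS yS zS.
have nxz : x != z by apply: contraNneq zS => <-.
have nyz : y != z by apply: contraNneq zS => <-.
have := val_perm_neq c.1 nxz; have := val_perm_neq c.2 nxz.
have := val_perm_neq c.1 nyz; have := val_perm_neq c.2 nyz.
case: (F y z); lia.
Qed.

(** On each pair flipping is an involution, so two flips cancel. *)
Lemma flipped_comp F G c c1 c2 : symmetric F ->
  flipped F c c1 -> flipped G c1 c2 -> flipped (fun x y => F x y (+) G x y) c c2.
Proof.
move=> symF fl1 fl2 x y; have [-> ->] := fl2 x y.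
have [e1 e2] := fl1 x y; have [e3 e4] := fl1 y x; rewrite symF in e3, e4.
by case: (G x y); rewrite ?e1 ?e2 ?e3 ?e4; case: (F x y).
Qed.

Lemma flipped_eq F G c c1 : F =2 G -> flipped F c c1 -> flipped G c c1.
Proof. by move=> FG fl x y; rewrite -FG; apply: fl. Qed.

(** * Flipping the classes of an equivalence relation *)

Section Classes.
Context (R : rel 'I_n) (Rxx : reflexive R) (symR : symmetric R) (transR : transitive R).

Lemma class_congr x y z : R x y -> R x z = R y z.
Proof.
by move=> xy; apply/idP/idP; apply: transR; rewrite // symR.
Qed.

(** A class may be met several times by [s]; it is flipped only at its last representative, lest two
    flips cancel. *)
Lemma flip_classes c (s : seq 'I_n) : (forall z, block c [set x | R z x]) ->
  exists2 c1, flipped (fun x y => R x y && has (R x) s) c c1 & reach c c1.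
Proof.
elim: s c => [|z s IHs] c bl.
  by exists c; [move=> x y; rewrite andbF | apply: reach_refl].
have [zs|zs] := boolP (has (R z) s).
  have [c1 fl rc] := IHs c bl; exists c1 => //; apply: flipped_eq fl => x y /=.
  have [xz|//] := boolP (R x z); rewrite andbT (_ : has (R x) s = true) ?andbT //.
  by rewrite -zs; apply: eq_has => u; apply: class_congr.
have [c1 fl1 rc1] := flip_block (bl z).
have [|c2 fl2 rc2] := IHs c1.
  move=> u; apply: flipped_block fl1 _ (bl u) => x y w; rewrite !inE => ux uy _.
  by congr (_ && _); rewrite ![R z _]symR; apply: class_congr; rewrite -(class_congr _ ux).
exists c2; last exact: reach_trans rc2.
have symF : symmetric (fun x y => (x \in [set x | R z x]) && (y \in [set x | R z x])).
  by move=> x y; rewrite andbC.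
apply: flipped_eq (flipped_comp symF fl1 fl2) => x y; rewrite !inE /=.
rewrite [R x z]symR; have [zx|zx] /= := boolP (R z x); last by [].
have -> : has (R x) s = false.
  by rewrite -(negPf zs); apply: eq_has => u; apply: class_congr; rewrite symR.
by rewrite andbF addbF andbT; apply: class_congr.
Qed.

(** The classes in [W] are flipped first, then [W] itself, so that pairs inside a class are flipped
    twice. *)
Lemma flip_across c W : (forall z, block c [set x | R z x]) -> block c W ->
  (forall x y, R x y -> x \in W -> y \in W) ->
  exists2 c1, flipped (fun x y => [&& x \in W, y \in W & ~~ R x y]) c c1 & reach c c1.
Proof.
move=> bl blW WR; have [c1 fl1 rc1] := flip_classes (enum W) bl.
have sR : symmetric (fun x y => R x y && has (R x) (enum W)).
  move=> x y; rewrite symR; have [yx|//] := boolP (R y x).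
  by apply: eq_has => u; apply: class_congr; rewrite symR.
have hasW x : has (R x) (enum W) = (x \in W).
  apply/hasP/idP => [[u]|xW]; last by exists x; rewrite ?mem_enum ?Rxx.
  by rewrite mem_enum => uW xu; apply: (WR u) => //; rewrite symR.
have blW1 : block c1 W.
  apply: flipped_block fl1 _ blW => x y z xW yW zW; rewrite !hasW xW yW !andbT.
  have nR u : u \in W -> R u z = false.
    by move=> uW; apply: contraNF zW => uz; apply: WR uz uW.
  by rewrite !nR.
have [c2 fl2 rc2] := flip_block blW1.
exists c2; last exact: reach_trans rc2.
apply: flipped_eq (flipped_comp sR fl1 fl2) => x y; rewrite hasW.
have [xW|xW] := boolP (x \in W); rewrite ?andbF //= andbT.
have [xy|] := boolP (R x y); first by rewrite (WR x y).
by rewrite addFb andbT.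
Qed.
End Classes.
End Configurations.

(** * Pairs of orders with the same inversions *)

Section Descent.
Context (n : nat).
Implicit Types (c : 'S_n * 'S_n) (S W : {set 'I_n}).

Definition agree c x y := (c.1 x < c.1 y) == (c.2 x < c.2 y).

Definition disagreement c c' :=
  #|[set p : 'I_n * 'I_n | (c.1 p.1 < c.1 p.2) != (c'.1 p.1 < c'.1 p.2)]|.

Lemma perm_ltC (p : 'S_n) x y : x != y -> (p y < p x) = ~~ (p x < p y).
Proof. by move=> nxy; have := val_perm_neq p nxy; lia. Qed.

Lemma perm_lt_trans (p : 'S_n) x y z : x != y -> y != z -> x != z ->
  (if p x < p y then (p y < p z) ==> (p x < p z) else (p x < p z) ==> (p y < p z)).
Proof.
move=> nxy nyz nxz; have := val_perm_neq p nxy; have := val_perm_neq p nyz.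
have := val_perm_neq p nxz.
by case: ltnP => ? ? ? ?; apply/implyP; lia.
Qed.

Section FixedTarget.
Context (c c' : 'S_n * 'S_n) (agree_cc' : forall x y, agree c x y = agree c' x y).

Definition pair_color x y : nat :=
  if agree c x y then if (c.1 x < c.1 y) == (c'.1 x < c'.1 y) then 1 else 2 else 0.

Lemma pair_colorC x y : x != y -> pair_color x y = pair_color y x.
Proof.
by move=> nxy; rewrite /pair_color /agree !(perm_ltC _ nxy) !eqb_negLR !negbK.
Qed.

(** In a rainbow triangle, [c.1] and [c'.1] would differ on exactly one pair (of colour 2) or
    coincide on exactly one (of colour 1), and so would [c.2] and [c'.2] on the same pair. That pair
    is then adjacent in [c.1] and in [c.2], so the third line sees both its ends on one side in each
    order; hence either both or none of the other two pairs have colour 0, a contradiction. The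
    proof checks all cases. *)
Lemma pair_color_no_rainbow x y z : x != y -> y != z -> x != z ->
  [|| pair_color x y == pair_color y z, pair_color y z == pair_color x z
    | pair_color x y == pair_color x z].
Proof.
move=> nxy nyz nxz; rewrite /pair_color.
have := agree_cc' x y; have := agree_cc' y z; have := agree_cc' x z.
have := perm_lt_trans c.1 nxy nyz nxz; have := perm_lt_trans c.2 nxy nyz nxz.
have := perm_lt_trans c'.1 nxy nyz nxz; have := perm_lt_trans c'.2 nxy nyz nxz.
rewrite /agree.
case: (c'.2 x < c'.2 y); case: (c'.2 y < c'.2 z); case: (c'.2 x < c'.2 z) => //=;
case: (c'.1 x < c'.1 y); case: (c'.1 y < c'.1 z); case: (c'.1 x < c'.1 z) => //=;
case: (c.2 x < c.2 y); case: (c.2 y < c.2 z); case: (c.2 x < c.2 z) => //=;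
by case: (c.1 x < c.1 y); case: (c.1 y < c.1 z); case: (c.1 x < c.1 z).
Qed.

(** If [z] were between [x] and [y] in one of the orders, the relations between the orders common to
    xz and yz would pass to xy by transitivity, and xy would have the same colour. *)
Lemma same_side x y z : x != y -> y != z -> x != z ->
  pair_color x z = pair_color y z -> pair_color x y != pair_color y z ->
  (c.1 x < c.1 z) = (c.1 y < c.1 z) /\ (c.2 x < c.2 z) = (c.2 y < c.2 z).
Proof.
move=> nxy nyz nxz; rewrite /pair_color.
have := agree_cc' x y; have := agree_cc' y z; have := agree_cc' x z.
have := perm_lt_trans c.1 nxy nyz nxz; have := perm_lt_trans c.2 nxy nyz nxz.
have := perm_lt_trans c'.1 nxy nyz nxz; have := perm_lt_trans c'.2 nxy nyz nxz.
rewrite /agree.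
case: (c'.2 x < c'.2 y); case: (c'.2 y < c'.2 z); case: (c'.2 x < c'.2 z) => //=;
case: (c'.1 x < c'.1 y); case: (c'.1 y < c'.1 z); case: (c'.1 x < c'.1 z) => //=;
case: (c.2 x < c.2 y); case: (c.2 y < c.2 z); case: (c.2 x < c.2 z) => //=;
by case: (c.1 x < c.1 y); case: (c.1 y < c.1 z); case: (c.1 x < c.1 z).
Qed.

(** [same_side] is applied along a path of colour [k]: the ends of each edge are joined to a line of
    [W] outside the component by one colour other than [k]. *)
Lemma component_block W k z : block c W ->
  block c [set x | connect (color_edge pair_color W k) z x].
Proof.
set e := color_edge _ _ _ => blW.
have symE : connect_sym e by apply: color_connect_sym pair_colorC _ _.
move=> x y t; rewrite !inE => zx zy zt.
have [zW|zW] := boolP (z \in W); last first.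
  have eqz u : connect e z u -> z = u.
    by case/connectP=> -[|v p] //= /andP[/and4P[]]; rewrite (negPf zW).
  by rewrite -(eqz _ zx) -(eqz _ zy).
have xW : x \in W by apply: color_connect_in zx zW.
have yW : y \in W by apply: color_connect_in zy zW.
have [tW|tW] := boolP (t \in W); last exact: blW.
have xy : connect e x y by rewrite symE in zx; apply: connect_trans zx zy.
have {zt} nxt : ~~ connect e x t by apply: contraNN zt; apply: connect_trans.
case/connectP: xy => p + ->; elim: p x xW nxt {zx zy yW} => //= u p IHp x xW nxt /andP[xu up].
have /and4P[_ uW nxu /eqP cxu] := xu.
have nut : ~~ connect e u t by apply: contraNN nxt; apply: connect_trans (connect1 xu).
have [<- <-] := IHp u uW nut up.
have nxt' : x != t by apply: contraNneq nxt => ->; apply: connect0.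
have nut' : u != t by apply: contraNneq nut => ->; apply: connect0.
have /andP[/eqP e1 e2] :=
  col_component pair_color_no_rainbow xW tW (connect1 xu) nxt.
by apply: same_side; rewrite // cxu eq_sym.
Qed.

(** Flipping leaves pairs of colour 0 alone and repairs those of colour 2; pairs of colour 1, which
    it would spoil, do not occur across classes. *)
Lemma flip_decreases W (R : rel 'I_n) x0 y0 :
    reflexive R -> symmetric R -> transitive R ->
    (forall z, block c [set x | R z x]) -> block c W ->
    (forall x y, R x y -> x \in W -> y \in W) ->
    (forall x y, x \in W -> y \in W -> ~~ R x y -> pair_color x y != 1) ->
    x0 \in W -> y0 \in W -> ~~ R x0 y0 -> pair_color x0 y0 = 2 ->
  exists c1, [/\ reach c c1, forall x y, agree c1 x y = agree c x y
               & disagreement c1 c' < disagreement c c'].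
Proof.
move=> Rxx symR transR blR blW WR ncol x0W y0W nR0 c0.
have [c1 fl rc] := flip_across Rxx symR transR blR blW WR.
exists c1; split=> // [x y|].
  rewrite /agree; have [-> ->] := fl x y; case: ifP => [/and3P[_ _ nR]|//].
  have nxy : x != y by apply: contraNneq nR => ->.
  by rewrite !(perm_ltC _ nxy) (inj_eq negb_inj) eq_sym.
apply/proper_card/properP; split.
  apply/subsetP=> -[x y]; rewrite !inE /=; have [-> _] := fl x y.
  case: ifP => [/and3P[xW yW nR]|//].
  have nxy : x != y by apply: contraNneq nR => ->.
  have := ncol x y xW yW nR; rewrite /pair_color /agree (perm_ltC _ nxy).
  by case: (c.1 x < c.1 y); case: (c.2 x < c.2 y); case: (c'.1 x < c'.1 y).
exists (x0, y0); rewrite !inE /=; move: c0; rewrite /pair_color.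
  by case: ifP => //; case: eqP => // /eqP.
have [-> _] := fl x0 y0; rewrite x0W y0W nR0 /=.
have nxy : x0 != y0 by apply: contraNneq nR0 => ->.
rewrite /agree (perm_ltC _ nxy).
by case: (c.1 x0 < c.1 y0); case: (c.2 x0 < c.2 y0); case: (c'.1 x0 < c'.1 y0).
Qed.

Lemma pair_color2_neq x y : pair_color x y = 2 -> x != y.
Proof. by apply: contra_eqN => /eqP ->; rewrite /pair_color /agree !ltnn. Qed.

Lemma pair_color2_between x y z : c.1 x < c.1 z -> c.1 z < c.1 y ->
  pair_color x y = 2 -> pair_color x z != 0 -> pair_color z y != 0 ->
  pair_color x z = 2 \/ pair_color z y = 2.
Proof.
move=> xz zy; have nxz : x != z by apply: contraTneq xz => ->; rewrite ltnn.
have nzy : z != y by apply: contraTneq zy => ->; rewrite ltnn.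
have xy := ltn_trans xz zy; have nxy : x != y by apply: contraTneq xy => ->; rewrite ltnn.
rewrite /pair_color xz zy xy.
have := perm_lt_trans c'.1 nxz nzy nxy.
case: (agree c x z); case: (agree c z y); case: (agree c x y) => //.
case: (c'.1 x < c'.1 z); case: (c'.1 z < c'.1 y); case: (c'.1 x < c'.1 y) => //=;
by [left | right].
Qed.

Lemma agree_step_in W x0 y0 : block c W -> x0 \in W -> y0 \in W ->
  pair_color x0 y0 = 2 ->
  exists c1, [/\ reach c c1, forall x y, agree c1 x y = agree c x y
               & disagreement c1 c' < disagreement c c'].
Proof.
have [m] := ubnP #|W|; elim: m W x0 y0 => // m IHm W x0 y0 leWm blW x0W y0W c0.
have gtW1 : 1 < #|W| by apply/card_gt1P; exists x0, y0; rewrite x0W y0W pair_color2_neq.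
have [k lt_k3 [u [v [uW vW nuv]]]] :=
  disconnected_color pair_colorC pair_color_no_rainbow gtW1.
set e := color_edge pair_color W k in nuv.
have symE : connect_sym e by apply: color_connect_sym pair_colorC _ _.
have transE : transitive (connect e) by move=> ? ? ?; apply: connect_trans.
have WE x y : connect e x y -> x \in W -> y \in W by apply: color_connect_in.
have blE z : block c [set x | connect e z x] by apply: component_block.
(* A component misses [u] or [v], so it is a smaller block and the induction hypothesis applies. *)
have inner x y : x \in W -> connect e x y -> pair_color x y = 2 ->
    exists c1, [/\ reach c c1, forall x y, agree c1 x y = agree c x y
               & disagreement c1 c' < disagreement c c'].
  move=> xW xy cxy; apply: (IHm [set z | connect e x z] x y); rewrite ?inE ?connect0 //.
  rewrite ltnS in leWm; apply: leq_trans leWm; apply/proper_card/properP; split.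
    by apply/subsetP=> z; rewrite inE => xz; apply: WE xz xW.
  have [xu|xu] := boolP (connect e x u); last by exists u; rewrite ?inE.
  by exists v; rewrite ?inE //; apply: contraNN nuv; apply: connect_trans; rewrite symE.
have [xy0|xy0] := boolP (connect e x0 y0); first exact: inner xy0 c0.
have edge x y : x \in W -> y \in W -> ~~ connect e x y -> pair_color x y != k.
  move=> xW yW; apply: contraNN => cxy; have [->|nxy] := eqVneq x y; first exact: connect0.
  by apply/connect1/and4P.
case: k lt_k3 @e nuv symE transE WE blE inner xy0 edge => [|[|[|//]]] _ e
  nuv symE transE WE blE inner xy0 edge.
(* A pair of colour 2 at minimal distance joins consecutive components of colour
   0, and the union of these is a block. *)
- pose P p := [&& p.1 \in W, p.2 \in W, pair_color p.1 p.2 == 2 & c.1 p.1 < c.1 p.2].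
  have [p0 Pp0] : exists p, P p.
    have [lt0|ge0] := ltnP (c.1 x0) (c.1 y0); first by exists (x0, y0); rewrite /P x0W y0W c0.
    exists (y0, x0); rewrite /P /= x0W y0W -pair_colorC ?c0 ?pair_color2_neq //=.
    by rewrite ltn_neqAle val_perm_neq // eq_sym pair_color2_neq.
  have [[x y] /and4P /= [xW yW /eqP cxy ltxy] miny] :=
    arg_minnP (fun p => c.1 p.2 - c.1 p.1) Pp0.
  have [xy|nxy] := boolP (connect e x y); first exact: inner xy cxy.
  pose B := [set z | connect e x z || connect e y z].
  have inB z : (z \in B) = connect e x z || connect e y z by rewrite inE.
  have BW z : z \in B -> z \in W by rewrite inB => /orP[] /WE->.
  have nyx : ~~ connect e y x by rewrite symE.
  have sideB z : z \notin B ->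
        (c.1 x < c.1 z) = (c.1 y < c.1 z) /\ (c.2 x < c.2 z) = (c.2 y < c.2 z).
    have [zW|zW _] := boolP (z \in W); last by apply: blW.
    rewrite inB negb_or => /andP[nxz nyz].
    have nxz' : x != z by apply: contraNneq nxz => ->; apply: connect0.
    have nyz' : y != z by apply: contraNneq nyz => ->; apply: connect0.
    have cxz := edge _ _ xW zW nxz; have := edge _ _ yW zW nyz; rewrite pair_colorC // => czy.
    (* A line between [x] and [y] would give a pair of colour 2 at smaller distance. *)
    have e1 : (c.1 x < c.1 z) = (c.1 y < c.1 z).
      have [ltxz|lezx] := ltnP (c.1 x) (c.1 z); last first.
        by apply/esym/negbTE; rewrite -leqNgt (leq_trans lezx) // ltnW.
      have [//|lezy] := ltnP (c.1 y) (c.1 z).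
      have ltzy : c.1 z < c.1 y by rewrite ltn_neqAle lezy eq_sym val_perm_neq.
      have [cxz2|czy2] := pair_color2_between ltxz ltzy cxy cxz czy.
        have := miny (x, z); rewrite /P /= xW zW cxz2 ltxz => /(_ isT).
        by rewrite leqNgt ltn_sub2r.
      have := miny (z, y); rewrite /P /= yW zW czy2 ltzy => /(_ isT).
      by rewrite leqNgt ltn_sub2l.
    (* Neither xz nor yz has colour 0, so the second order follows the first on both. *)
    split=> //; move: cxz czy; rewrite [pair_color z y]pair_colorC 1?eq_sym // /pair_color.
    by rewrite /agree e1; case: (c.1 y < c.1 z); case: (c.2 x < c.2 z); case: (c.2 y < c.2 z).
  have blB : block c B.
    have side w z : w \in B -> z \notin B ->
        (c.1 w < c.1 z) = (c.1 x < c.1 z) /\ (c.2 w < c.2 z) = (c.2 x < c.2 z).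
      move=> + zB; move: (zB); rewrite !inB negb_or => /andP[nxz nyz] /orP[xw|yw].
        by apply: (blE x); rewrite !inE ?connect0.
      by have [-> ->] := sideB z zB; apply: (blE y); rewrite !inE ?connect0.
    by move=> s t z sB tB zB; have [-> ->] := side s z sB zB; have [-> ->] := side t z tB zB.
  apply: (@flip_decreases B (connect e) x y) => //; rewrite ?inB ?connect0 ?orbT //.
    by move=> s t st; rewrite !inB => /orP[] h; rewrite (connect_trans h st) ?orbT.
  (* All pairs between two distinct components have one colour, here that of xy. *)
  have cross s t : connect e x s -> connect e y t -> pair_color s t = 2.
    move=> xs yt; have sW := WE _ _ xs xW; have tW := WE _ _ yt yW.
    have nsy : ~~ connect e s y by apply: contraNN nxy; apply: connect_trans.
    have nys : ~~ connect e y s by rewrite symE.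
    have [/andP[/eqP e1 _] /andP[/eqP e2 _]] :=
      (col_component pair_color_no_rainbow xW yW xs nxy,
       col_component pair_color_no_rainbow yW sW yt nys).
    have nst : s != t by apply: contraNneq nys => ->.
    have nsy' : y != s by apply: contraNneq nys => ->; apply: connect0.
    by rewrite pair_colorC // -e2 pair_colorC // -e1.
  move=> s t; rewrite !inB => /orP[xs|ys] /orP[xt|yt] nst.
  - by case/negP: nst; apply: connect_trans xt; rewrite symE.
  - by rewrite cross.
  - by rewrite pair_colorC ?cross //; apply: contraNneq nst => ->; apply: connect0.
  - by case/negP: nst; apply: connect_trans yt; rewrite symE.
(* For components of colour 1, no pair across them has colour 1, so [W] itself can be used. *)
- by apply: (@flip_decreases W (connect e) x0 y0).
(* For components of colour 2, the pair of [x0] and [y0] would itself be an edge. *)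
by have := edge _ _ x0W y0W xy0; rewrite c0.
Qed.

End FixedTarget.

Lemma agree_mirror c x y : x != y -> agree (mirror c) x y = ~~ agree c x y.
Proof.
by move=> nxy; rewrite /agree mirror_lt (perm_ltC _ nxy); case: (_ < _); case: (_ < _).
Qed.

Lemma agree_mirror_congr c c1 : (forall x y, agree c x y = agree c1 x y) ->
  forall x y, agree (mirror c) x y = agree (mirror c1) x y.
Proof.
move=> cc1 x y; have [->|nxy] := eqVneq x y; first by rewrite /agree !ltnn.
by rewrite !agree_mirror // cc1.
Qed.

Lemma agree_step c c' x0 y0 : (forall x y, agree c x y = agree c' x y) ->
  agree c x0 y0 -> (c.1 x0 < c.1 y0) != (c'.1 x0 < c'.1 y0) ->
  exists c1, [/\ reach c c1, forall x y, agree c1 x y = agree c x y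
               & disagreement c1 c' < disagreement c c'].
Proof.
move=> cc' a0 d0; apply: (@agree_step_in _ _ cc' setT x0 y0) => //.
  by move=> x y z _ _; rewrite inE.
by rewrite /pair_color a0 (negPf d0).
Qed.

Lemma agree_reach c c' : (forall x y, agree c x y = agree c' x y) -> reach c c'.
Proof.
have [m] := ubnP (disagreement c c'); elim: m c => // m IHm c lem cc'.
have [d0|[[x y]]] :=
  set_0Vmem [set p : 'I_n * 'I_n | (c.1 p.1 < c.1 p.2) != (c'.1 p.1 < c'.1 p.2)].
  have eq_lt x y : (c.1 x < c.1 y) = (c'.1 x < c'.1 y).
    by have := in_set0 (x, y); rewrite -d0 inE /= => /negbFE/eqP.
  suff <- : c = c' by apply: reach_refl.
  case: c c' eq_lt cc' {d0 IHm lem} => [a b] [a' b'] /= eq_lt cc'.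
  congr pair; apply: perm_eq_ltn => // x y.
  by have := cc' x y; rewrite /agree /= eq_lt; do 3!case: (_ < _).
rewrite inE /= => dxy.
have nxy : x != y by apply: contraNneq dxy => ->; rewrite !ltnn.
have [axy|naxy] := boolP (agree c x y).
  have [c1 [rc1 ac1 dc1]] := agree_step cc' axy dxy.
  by apply: reach_trans rc1 _; apply: IHm => [|s t]; rewrite ?ac1 //; lia.
(* After [mirror] the orders agree on this pair. The first orders, and with them [disagreement], are
   unchanged. *)
have [|c1 [rc1 ac1 dc1]] := agree_step (agree_mirror_congr cc') _ dxy.
  by rewrite agree_mirror.
apply: reach_trans (reach_mirror rc1) _; apply: IHm; first exact: leq_trans dc1 lem.
by move=> s t; rewrite (agree_mirror_congr ac1) mirrorK.
Qed.

End Descent.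

(** * Switching *)

Section Switching.
Local Open Scope ring_scope.

Definition sg_sub (x y : nat) : int := Num.sg (x%:Z - y%:Z).

Lemma sg_sub_lt x y : (x < y)%N -> sg_sub x y = -1.
Proof. by move=> lt_xy; apply/ltr0_sg; rewrite subr_lt0 ltz_nat. Qed.

Lemma sg_sub_gt x y : (y < x)%N -> sg_sub x y = 1.
Proof. by move=> lt_yx; apply/gtr0_sg; rewrite subr_gt0 ltz_nat. Qed.

Lemma sg_subxx x : sg_sub x x = 0.
Proof. by rewrite /sg_sub subrr sgr0. Qed.

Lemma sg_sub_rev k x y : (x < k)%N -> (y < k)%N ->
  sg_sub (k - 1 - x) (k - 1 - y) = - sg_sub x y.
Proof.
move=> ltx lty; case: (ltngtP x y) => [lt|lt|->]; last by rewrite !sg_subxx oppr0.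
  by rewrite (sg_sub_lt lt) sg_sub_gt ?opprK //; lia.
by rewrite (sg_sub_gt lt) sg_sub_lt //; lia.
Qed.

Definition wrap_sign (n t x : nat) : int := if (x + t < n)%N then 1 else -1.

Lemma wrap_signK n t x : wrap_sign n t x * wrap_sign n t x = 1.
Proof. by rewrite /wrap_sign; case: ifP => _; rewrite ?mulrNN mulr1. Qed.

(** The order of two points is reversed exactly when one of them wraps around and the other does
    not. *)
Lemma sg_sub_rot n t x y : (t < n)%N -> (x < n)%N -> (y < n)%N ->
  sg_sub ((x + t) %% n) ((y + t) %% n) = wrap_sign n t x * wrap_sign n t y * sg_sub x y.
Proof.
move=> ltt.
have modE z : (z < n)%N -> ((z + t) %% n = if z + t < n then z + t else z + t - n)%N.
  move=> ltz; case: ltnP => [/modn_small //|le].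
  rewrite -[in LHS](subnK le) modnDr modn_small //.
  by lia.
move=> ltx lty; rewrite !modE // /wrap_sign.
case: ifP => xt; case: ifP => yt; rewrite ?mulr1 ?mul1r ?mulrNN ?mul1r ?mulN1r.
- by rewrite /sg_sub !PoszD opprD addrACA subrr addr0.
- by rewrite (sg_sub_gt (x := x + t)) 1?(sg_sub_lt (x := x)) ?opprK //; lia.
- by rewrite (sg_sub_lt (y := y + t)) 1?(sg_sub_gt (x := x)) //; lia.
have -> : (x + t - n = x - (n - t))%N by lia.
have -> : (y + t - n = y - (n - t))%N by lia.
rewrite /sg_sub -!subzn; lia.
Qed.

Lemma linking_mxE n (sigma : 'S_n) i j :
  linking_mx sigma i j = sg_sub i j * sg_sub (sigma i) (sigma j).
Proof. by rewrite mxE sgrM. Qed.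

Lemma linking_mx_eq1 n (sigma : 'S_n) i j : i != j ->
  (linking_mx sigma i j == 1) = ((i < j)%N == (sigma i < sigma j)%N).
Proof.
move=> nij; rewrite linking_mxE; have := val_perm_neq sigma nij.
have : i != j :> nat by rewrite (inj_eq val_inj).
case: (ltngtP i j) => // ij _; case: (ltngtP (sigma i) (sigma j)) => // sij _.
all: by rewrite ?(sg_sub_lt ij) ?(sg_sub_gt ij) ?(sg_sub_lt sij) ?(sg_sub_gt sij).
Qed.

(** Switching-equivalence entry by entry, with explicit data that can be composed. Over the integers
    [d i * d i = 1] says that [d i] is a sign. *)
Definition switched n (sigma tau : 'S_n) (p : 'S_n) (d : 'I_n -> int) : Prop :=
  (forall i, d i * d i = 1) /\
  forall i j, linking_mx tau i j = d i * d j * linking_mx sigma (p i) (p j).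

Lemma switching_equivP n (sigma tau : 'S_n) :
  switching_equiv (linking_mx sigma) (linking_mx tau) <->
  exists p d, switched sigma tau p d.
Proof.
have entry (s : 'S_n) (d : 'rV[int]_n) (X : 'M[int]_n) i j :
    (diag_mx d *m (perm_mx s)^T *m X *m perm_mx s *m diag_mx d) i j =
    d 0 i * d 0 j * X ((s^-1)%g i) ((s^-1)%g j).
  have -> : diag_mx d *m (perm_mx s)^T *m X *m perm_mx s =
      diag_mx d *m row_perm s^-1 (col_perm s^-1 X).
    by rewrite row_permE col_permE invgK tr_perm_mx !mulmxA.
  by rewrite mul_mx_diag mul_diag_mx !mxE mulrAC.
split=> [[_ [_ [/is_perm_mxP[s ->] [/diag_mxP[d ->] dd] eY]]]|[p [d [dd eY]]]].
  exists (s^-1)%g, (d 0); split=> [i|i j]; last by rewrite eY entry.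
  by have := dd i; rewrite mxE eqxx mulr1n => -[] ->; rewrite ?mulrNN mulr1.
exists (perm_mx p^-1), (diag_mx (\row_i d i)); split.
- exact: perm_mx_is_perm.
- split=> [|i]; first exact: diag_mx_is_diag.
  rewrite mxE eqxx mulr1n mxE; have : d i ^+ 2 == 1 ^+ 2 by rewrite expr1n expr2 dd.
  by rewrite eqf_sqr => /orP[] /eqP; [left | right].
by apply/matrixP=> i j; rewrite entry invgK eY !mxE.
Qed.

Lemma switched_refl n (sigma : 'S_n) : switched sigma sigma 1 (fun=> 1).
Proof. by split=> [i|i j]; rewrite ?perm1 ?mulr1 ?mul1r. Qed.

Lemma switched_sym n (sigma tau p : 'S_n) d : switched sigma tau p d ->
  switched tau sigma p^-1 (fun i => d (p^-1 i)%g).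
Proof.
move=> [dd e]; split=> [i|i j]; first exact: dd.
by rewrite e !permKV mulrA [_ * _ * (_ * _)]mulrACA !dd mulr1 mul1r.
Qed.

Lemma switched_trans n (sigma tau mu p q : 'S_n) d e :
  switched sigma tau p d -> switched tau mu q e ->
  switched sigma mu (q * p) (fun i => e i * d (q i)).
Proof.
move=> [dd eY] [ee eZ]; split=> [i|i j]; first by rewrite mulrACA ee dd mulr1.
by rewrite eZ eY !permM mulrA; congr (_ * _); rewrite mulrACA.
Qed.

(** * Spindle moves preserve the switching class *)

Lemma circular_switched n (sigma : 'S_n) s t :
  exists d, switched sigma (rotp n t * sigma * rotp n s)%g (rotp n t) d.
Proof.
have [n0|n_gt0] := posnP n.
  by exists (fun=> 1); split=> i; have := ltn_ord i; rewrite {2}n0.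
rewrite -(rotp_modn n t) -(rotp_modn n s).
have lts : (s %% n < n)%N by rewrite ltn_mod.
have ltt : (t %% n < n)%N by rewrite ltn_mod.
move: (s %% n)%N (t %% n)%N lts ltt => {}s {}t lts ltt.
(* One sign for the rotation of the places, one for that of the values. *)
exists (fun i : 'I_n => wrap_sign n t i * wrap_sign n s (sigma (rotp n t i))).
split=> [i|i j]; first by rewrite mulrACA !wrap_signK mulr1.
rewrite !linking_mxE !permM !(rotpE s) sg_sub_rot // !rotpE sg_sub_rot //.
set u := sg_sub i j; set v := sg_sub _ _.
set a := wrap_sign n t i; set b := wrap_sign n t j.
transitivity ((a * a) * (b * b) * (u * (wrap_sign n s (sigma (rotp n t i)) *
  wrap_sign n s (sigma (rotp n t j)) * v))); last by ring.
by rewrite !wrap_signK !mul1r.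
Qed.

(** A pair with one place in the block and one outside has coefficient 1 in both matrices, since the
    block comes first in both orders. *)
Lemma block_switched n (sigma mu p : 'S_n) k :
  (forall i, (sigma i < k)%N = (i < k)%N) -> (forall i, (mu i < k)%N = (i < k)%N) ->
  (forall i, (p i < k)%N = (i < k)%N) ->
  (forall i : 'I_n, (k <= i)%N -> p i = i /\ mu i = sigma i) ->
  (forall i j : 'I_n, (i < k)%N -> (j < k)%N ->
     linking_mx mu i j = linking_mx sigma (p i) (p j)) ->
  switched sigma mu p (fun=> 1).
Proof.
move=> ks km kp out inn; split=> [i|i j]; rewrite !mul1r //.
have [ik|ki] := ltnP i k; have [jk|kj] := ltnP j k; first exact: inn.
- have [ej mj] := out j kj; rewrite !linking_mxE ej mj.
  have ltk (x y : 'I_n) : (x < k)%N -> (k <= y)%N -> (x < y)%N by apply: leq_trans.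
  have ksj : (k <= sigma j)%N by rewrite leqNgt ks -leqNgt.
  rewrite (sg_sub_lt (ltk _ _ ik kj)) !sg_sub_lt // ltk ?kp ?km ?ks ?kp //.
- have [ei mi] := out i ki; rewrite !linking_mxE ei mi.
  have ltk (x y : 'I_n) : (x < k)%N -> (k <= y)%N -> (x < y)%N by apply: leq_trans.
  have ksi : (k <= sigma i)%N by rewrite leqNgt ks -leqNgt.
  rewrite (sg_sub_gt (ltk _ _ jk ki)) !sg_sub_gt // ltk ?kp ?km ?ks ?kp //.
by have [-> mi] := out i ki; have [-> mj] := out j kj; rewrite !linking_mxE mi mj.
Qed.

Lemma imset_initial_block n (sigma : 'S_n) k :
  sigma @: initial_block n k = initial_block n k -> forall i, (sigma i < k)%N = (i < k)%N.
Proof.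
move=> blk i; have := mem_imset (mem (initial_block n k)) i (@perm_inj _ sigma).
by rewrite blk !inE.
Qed.

Lemma perm_on_initial n (f : 'S_n) k : (forall i, (f i < k)%N = (i < k)%N) ->
  exists p : 'S_n, forall i, p i = if (i < k)%N then f i else i.
Proof.
move=> kf; have inj : injective (fun i : 'I_n => if (i < k)%N then f i else i).
  move=> i j; case: ifPn => ik; case: ifPn => jk // e; first exact: perm_inj e.
    by rewrite -e kf ik in jk.
  by rewrite e kf jk in ik.
by exists (perm inj) => i; rewrite permE.
Qed.

Lemma spindle_move_switched n (sigma mu : 'S_n) : spindle_move sigma mu ->
  exists p d, switched sigma mu p d.
Proof.
case=> [[s [t [lts ltt mv]]]|[k [/andP[k_gt0 le_kn] blk inn out]]|[k [_ blk inn out]]].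
- have -> : mu = (rotp n t * sigma * rotp n s)%g.
    apply/permP=> i; apply/ord_inj; rewrite !permM rotpE addnC.
    by apply: mv; rewrite rotpE.
  by have [d sw] := circular_switched sigma s t; exists (rotp n t), d.
(* Vertical reflection: [p] reverses the block, and both factors of a coefficient change sign. *)
- have ks := imset_initial_block blk.
  have [p pE] : exists p : 'S_n, forall i, p i = (if i < k then k - 1 - i else i)%N :> nat.
    apply: perm_of_nat_inj => [i|i j] /=.
      by have := ltn_ord i; case: ifP => _; lia.
    by move=> e; apply/ord_inj; move: e; do 2![case: ltnP => ?]; lia.
  have mE (i : 'I_n) : (i < k)%N -> mu i = (k - 1 - sigma (p i))%N :> nat.
    by move=> ik; apply: inn; rewrite // pE ik.
  exists p, (fun=> 1); apply: (@block_switched _ _ _ _ k) => // [i|i|i ki|i j ik jk].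
  + have [ik|ki] := ltnP i k; first by rewrite mE //; lia.
    by rewrite out // ks ltnNge ki.
  + by rewrite pE; case: ifP; lia.
  + by rewrite out //; split=> //; apply/ord_inj; rewrite pE ltnNge ki.
  have kp (x : 'I_n) : (x < k)%N -> (p x < k)%N by move=> xk; rewrite pE xk; lia.
  have eqrev (x : 'I_n) : (x < k)%N -> x = (k - 1 - p x)%N :> nat.
    by move=> xk; rewrite pE xk; lia.
  rewrite !linking_mxE !mE // {1}(eqrev i ik) {1}(eqrev j jk).
  by rewrite !sg_sub_rev ?ks ?kp // mulrNN.
(* Horizontal reflection: [p] is the inverse of [sigma] on the block, and the two factors of a
   coefficient are exchanged. *)
have ks := imset_initial_block blk.
have ksV i : ((sigma^-1)%g i < k)%N = (i < k)%N by rewrite -ks permKV.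
have [p pE] := perm_on_initial ksV.
exists p, (fun=> 1); apply: (@block_switched _ _ _ _ k) => // [i|i|i ki|i j ik jk].
- have [ik|ki] := ltnP i k; first by rewrite inn // ksV.
  by rewrite out // ks ltnNge ki.
- by rewrite pE; case: ifP; rewrite ?ksV.
- by rewrite out // pE ltnNge ki.
by rewrite !linking_mxE !pE ik jk !inn // !permKV mulrC.
Qed.

Lemma spindle_equiv_switched n (sigma mu : 'S_n) : spindle_equiv sigma mu ->
  exists p d, switched sigma mu p d.
Proof.
elim=> {sigma mu} [sigma mu|sigma|sigma mu _ [p [d sw]]|
    s1 s2 s3 _ [p [d sw]] _ [q [e sw']]].
- exact: spindle_move_switched.
- by eexists; eexists; apply: switched_refl.
- by eexists; eexists; apply: switched_sym sw.
by eexists; eexists; apply: switched_trans sw sw'.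
Qed.

(** * From switching classes back to spindle-equivalence *)

Lemma linking_mx_spindle n (sigma tau p : 'S_n) :
  (forall i j, linking_mx tau i j = linking_mx sigma (p i) (p j)) ->
  spindle_equiv tau sigma.
Proof.
(* Lines are named by their places in [tau]; [p] gives their places in [sigma]. *)
move=> eL; have [|+ _] := @agree_reach n (1, tau)%g (p, p * sigma)%g.
  move=> i j; have [->|nij] := eqVneq i j; first by rewrite /agree !ltnn.
  rewrite /agree /= !permM !perm1 -linking_mx_eq1 // eL linking_mx_eq1 //.
  by rewrite (inj_eq perm_inj).
by rewrite /config_perm /= invg1 mul1g mulKg.
Qed.

(* The row of o in the linking matrix of tau consists of ones. *)
Lemma circular_normalize n (sigma : 'S_n) (v o : 'I_n) : o = 0%N :> nat ->
  exists tau p d, [/\ spindle_equiv sigma tau, switched sigma tau p d, p o = v & tau o = o].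
Proof.
move=> o0; pose tau := (rotp n v * sigma * rotp n (n - sigma v))%g.
have [d sw] := circular_switched sigma (n - sigma v) v.
have po : rotp n v o = v by apply/ord_inj; rewrite rotpE o0 add0n modn_small.
exists tau, (rotp n v), d; split=> //; first exact: circular_equiv.
by apply/ord_inj; rewrite /tau !permM po rotpE subnKC ?modnn ?o0 // ltnW.
Qed.

Lemma switched_spindle n (sigma sigma' p : 'S_n) d : (0 < n)%N ->
  switched sigma sigma' p d -> spindle_equiv sigma sigma'.
Proof.
move=> n_gt0 sw; pose o := Ordinal n_gt0.
have [tau' [p' [d' [eq' sw' p'o tau'o]]]] := @circular_normalize n sigma' o o erefl.
(* The line brought to the front is the one corresponding to [o], so that the composite relabelling
   [r] fixes [o]. *)
have [tau [q [e [eq swq qo tauo]]]] := @circular_normalize n sigma (p o) o erefl.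
have [r [f [ro [ff eL]]]] : exists (r : 'S_n) f, r o = o /\ switched tau tau' r f.
  eexists; eexists; split; last first.
    exact: switched_trans (switched_trans (switched_sym swq) sw) sw'.
  by rewrite !permM p'o -qo permK.
have row (mu : 'S_n) i : mu o = o -> i != o -> linking_mx mu o i = 1.
  move=> muo nio; have gt0 (x : 'I_n) : x != o -> (o < x)%N.
    by rewrite -(inj_eq val_inj) /= lt0n.
  rewrite linking_mxE muo !sg_sub_lt ?mulrNN ?mulr1 ?gt0 //.
  by rewrite -muo (inj_eq perm_inj).
(* Off the diagonal, the rows of [o] in both matrices consist of ones; hence [f] is constant and its
   signs cancel. *)
have f1 i : f o * f i = 1.
  have [->|nio] := eqVneq i o; first exact: ff.
  have := eL o i; rewrite row // ro row ?mulr1 //.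
  by rewrite -ro (inj_eq perm_inj).
have fij i j : f i * f j = 1.
  by rewrite -[LHS]mul1r -(ff o) mulrACA !f1 mulr1.
apply: spindle_trans eq _; apply: spindle_trans (spindle_sym eq').
apply/spindle_sym/(@linking_mx_spindle _ tau tau' r) => i j.
by rewrite eL fij mul1r.
Qed.

End Switching.

Theorem corollary1p2 (n : nat) (hn : (1 <= n)%N) (sigma sigma' : 'S_n) :
  switching_equiv (linking_mx sigma) (linking_mx sigma')
  <-> spindle_equiv sigma sigma'.
Proof.
rewrite switching_equivP; split=> [[p [d sw]]|]; first exact: switched_spindle sw.
exact: spindle_equiv_switched.
Qed.
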